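(* Let $\Lambda:\mathbb{R}\to[0,1]$ be decreasing. Then $$\mathrm{ES}_\Lambda(X)=\sup_{\mathbb Q\in\mathcal M_{1,f}}R(\mathbb E_{\mathbb Q}[X],\mathbb Q),\quad X\in L^\infty,$$ where for $(t,\mathbb Q)\in\mathbb{R}\times\mathcal M_{1,f}$, $$R(t,\mathbb Q)=\sup_{x\in\mathbb{R}}\left\{t\wedge x:\ \Lambda(x)\ge1-\frac{\mathrm d\mathbb P}{\mathrm d\mathbb Q},\ \mathbb Q\text{-almost surely}\right\}.$$ Moreover: (i) the supremum over $\mathbb Q$ is attained if $\Lambda$ is left-continuous; (ii) $(t,\mathbb Q)\mapsto R(t,\mathbb Q)$ is upper semicontinuous, quasi-concave, and increasing in $t$; (iii) $\inf_{t\in\mathbb{R}}R(t,\mathbb Q)=\inf_{t\in\mathbb{R}}R(t,\mathbb Q')$ for all $\mathbb Q,\mathbb Q'\in\mathcal M_{1,f}$; (iv) $R(t_1,\mathbb Q)-R(t_2,\mathbb Q)\le t_1-t_2$ for all $t_1\ge t_2$ and $\mathbb Q\in\mathcal M_{1,f}$.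
   Context: $(\Omega,\mathcal F,\mathbb P)$ is an atomless probability space, $L^0$ all random variables, $L^\infty$ essentially bounded ones; ''decreasing'' is weak; $\wedge=\min$. $\mathcal M_{1,f}$ is the set of finitely additive probability measures on $(\Omega,\mathcal F)$ absolutely continuous with respect to $\mathbb P$; $\mathrm d\mathbb P/\mathrm d\mathbb Q$ denotes $1/(\mathrm d\mathbb Q/\mathrm d\mathbb P)$ with $1/0=\infty$. For $\alpha\in[0,1]$, $X\in L^0$: $\mathrm{VaR}_\alpha(X)=\inf\{x\in\mathbb{R}:\mathbb P(X\le x)\ge\alpha\}$. For $X\in L^\infty$: $\mathrm{ES}_\alpha(X)=\frac{1}{1-\alpha}\int_\alpha^1\mathrm{VaR}_\beta(X)\,\mathrm d\beta$ for $\alpha<1$, $\mathrm{ES}_1(X)=\mathrm{VaR}_1(X)$; $\mathrm{ES}_\Lambda(X)=\sup_{x\in\mathbb{R}}\left(\mathrm{ES}_{\Lambda(x)}(X)\wedge x\right)$.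
   Formalization: Since a merely finitely additive Q has no density dQ/dP, the condition ''Λ(x) ≥ 1 − dP/dQ, Q-almost surely'' is read as (1 − Λ(x))Q(A) ≤ P(A) for every measurable A, which is equivalent when Q is countably additive. *)

(* Defs.v *)
From HB Require Import structures.
From mathcomp Require Import all_boot all_order all_algebra.
From mathcomp Require Import all_classical all_reals all_analysis.
Set Implicit Arguments. Unset Strict Implicit. Unset Printing Implicit Defensive.
Import Order.TTheory GRing.Theory Num.Theory.
Import numFieldNormedType.Exports.
Local Open Scope classical_set_scope.
Local Open Scope ring_scope.

Section ESLambda.
Context {d : measure_display} {T : measurableType d} {R : realType}.
Variable P : probability T R.

Definition atomless : Prop :=
  forall A : set T, measurable A -> (0 < P A)%E ->
    exists B : set T, [/\ measurable B, B `<=` A, (0 < P B)%E & (P B < P A)%E].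

Definition Linf (X : T -> R) : Prop :=
  measurable_fun [set: T] X /\ exists C : R, {ae P, forall w, `|X w| <= C}.

Definition VaR (alpha : R) (X : T -> R) : \bar R :=
  ereal_inf [set x%:E | x in [set x : R | (alpha%:E <= P [set w | (X w <= x)%R])%E]].

Definition ES (alpha : R) (X : T -> R) : \bar R :=
  if alpha < 1 then
    (((1 - alpha)^-1)%:E *
      \int[@lebesgue_measure R]_(b in `]alpha, 1%R]%classic) VaR b X)%E
  else VaR 1 X.

Definition ES_Lam (Lam : R -> R) (X : T -> R) : \bar R :=
  ereal_sup [set Order.min (ES (Lam x) X) x%:E | x in [set: R]].

Definition M1f (Q : set T -> R) : Prop :=
  [/\ Q [set: T] = 1,
      (forall A, measurable A -> 0 <= Q A),
      (forall A B, measurable A -> measurable B -> A `&` B = set0 ->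
          Q (A `|` B) = Q A + Q B) &
      (forall A, measurable A -> P A = 0%E -> Q A = 0)].

(* E_Q[X] for a finitely additive Q and X in L^infty: the (lower) integral,
   sup of the Q-integrals of simple functions lying P-a.s. below X *)
Definition EQ (Q : set T -> R) (X : T -> R) : R :=
  sup [set r : R | exists (n : nat) (a : 'I_n -> R) (A : 'I_n -> set T),
        [/\ (forall i, measurable (A i)),
            {ae P, forall w, \sum_(i < n) a i * \1_(A i) w <= X w} &
            r = \sum_(i < n) a i * Q (A i)]].

(* the condition  Lambda(x) >= 1 - dP/dQ  Q-a.s. *)
Definition Rcond (Lam : R -> R) (Q : set T -> R) (x : R) : Prop :=
  forall A, measurable A -> (((1 - Lam x) * Q A)%:E <= P A)%E.

Definition Rfun (Lam : R -> R) (t : R) (Q : set T -> R) : \bar R :=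
  ereal_sup [set (Num.min t x)%:E | x in [set x | Rcond Lam Q x]].

Definition mixQ (l : R) (Q1 Q2 : set T -> R) : set T -> R :=
  fun A => l * Q1 A + (1 - l) * Q2 A.

(* upper semicontinuity of (t,Q) |-> F t Q on R x M_{1,f}, where M_{1,f}
   carries the weak* topology sigma(ba, L^infty) *)
Definition usc_RM1f (F : R -> (set T -> R) -> \bar R) : Prop :=
  forall (t : R) (Q : set T -> R) (c : R), M1f Q -> (F t Q < c%:E)%E ->
    exists eps : R, 0 < eps /\
    exists (n : nat) (Xs : 'I_n -> T -> R), (forall i, Linf (Xs i)) /\
      forall (s : R) (Q' : set T -> R), M1f Q' -> `|s - t| < eps ->
        (forall i, `|EQ Q' (Xs i) - EQ Q (Xs i)| < eps) ->
        (F s Q' < c%:E)%E.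

Definition quasi_concave_RM1f (F : R -> (set T -> R) -> \bar R) : Prop :=
  forall (t1 t2 l : R) (Q1 Q2 : set T -> R), M1f Q1 -> M1f Q2 ->
    0 <= l <= 1 ->
    (Order.min (F t1 Q1) (F t2 Q2) <= F (l * t1 + (1 - l) * t2)%R (mixQ l Q1 Q2))%E.

End ESLambda.

(* Main.v *)
(* Write x(Q) for the supremum of the levels x such that (1 - Lam x) Q <= P; the
   set of these levels is a down-set, so R(t, Q) = min(t, x(Q)).  Hence the
   duality reduces to ES_a(X) = sup {E_Q[X] : (1 - a) Q <= P}, with a = Lam x.
   For a < 1 and any a-quantile q of X, the quantile transform turns the
   definition of ES into the Rockafellar-Uryasev formula
   ES_a(X) = q + E[(X - q)^+] / (1 - a), which bounds E_Q[X] by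
   E_Q[X] <= q + E_Q[(X - q)^+], and which is reached by putting the maximal
   density 1 / (1 - a) on {X > q} and the remaining mass on {X = q}.  For a = 1,
   P conditioned on {X > ess sup X - e} is e-optimal.  The supremum over Q is
   attained because M_{1,f} is weak* compact: a maximizing sequence has a limit
   along an ultrafilter.  R is upper semicontinuous since x(Q) < x is witnessed
   by the strict inequality (1 - Lam x) Q(A) > P(A) for a single event A. *)

Require Import Defs.
From HB Require Import structures.
From mathcomp Require Import all_boot all_order all_algebra.
From mathcomp Require Import all_classical all_reals all_analysis.
From mathcomp Require Import measurable_realfun ring lra.
Set Implicit Arguments. Unset Strict Implicit. Unset Printing Implicit Defensive.
Import Order.TTheory GRing.Theory Num.Theory.
Import numFieldNormedType.Exports.
Local Open Scope classical_set_scope.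
Local Open Scope ring_scope.

(** * Finitely additive probabilities and simple functions *)

Section finitely_additive.
Context {d : measure_display} {T : measurableType d} {R : realType}.
Variable P : probability T R.
Implicit Types (Q : set T -> R) (X : T -> R).

Lemma fine_M1f : M1f P (fun A => fine (P A)).
Proof.
split => [|A mA|A B mA mB AB0|A mA ->//].
- by rewrite probability_setT.
- exact: fine_ge0.
- by rewrite measureU// fineD ?fin_num_measure.
Qed.

Lemma M1f_set0 Q : M1f P Q -> Q set0 = 0.
Proof. by case=> _ _ _; apply; [exact: measurable0|exact: measure0]. Qed.

Lemma M1f_le1 Q (A : set T) : M1f P Q -> measurable A -> Q A <= 1.
Proof.
case=> Q1 Q0 QU _ mA; rewrite -Q1 -(setUv A) QU ?setICr//.
  by rewrite lerDl Q0//; exact: measurableC.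
exact: measurableC.
Qed.

(** Induction on a duplicate-free enumeration of [S]: a new fibre is disjoint from the union of the
    previous ones. Measurability of that union is carried along, since additivity is assumed on
    measurable sets only. *)
Lemma M1f_preimage (F : finType) (f : T -> F) Q : M1f P Q ->
  (forall y, measurable (f @^-1` [set y])) -> forall S : {pred F},
  Q (f @^-1` [set` S]) = \sum_(y in S) Q (f @^-1` [set y]).
Proof.
move=> hQ mf S; have Q0 := M1f_set0 hQ; case: hQ => _ _ QU _.
have H (s : seq F) : uniq s -> measurable (f @^-1` [set` s]) /\
    Q (f @^-1` [set` s]) = \sum_(y <- s) Q (f @^-1` [set y]).
  elim: s => [_|y s IH /= /andP[ys /IH[mS IHs]]].
    rewrite big_nil (_ : _ @^-1` _ = set0) ?Q0; first by split.
    by apply/seteqP; split => w.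
  have -> : f @^-1` [set` y :: s] = f @^-1` [set y] `|` f @^-1` [set` s].
    apply/seteqP; split => w /=.
      by rewrite inE => /predU1P[->|]; [left|right].
    by rewrite inE => -[->|->]; rewrite ?eqxx ?orbT.
  rewrite big_cons -IHs QU//.
    by split => //; exact: measurableU.
  apply/seteqP; split => w //= -[fw fs]; move: ys.
  by rewrite -fw fs.
have [_ ] := H (enum S) (enum_uniq S).
rewrite big_enum /= => <-.
by congr Q; apply/seteqP; split => w /=; rewrite mem_enum.
Qed.

(* The atoms of the algebra generated by the [A i] are the fibres of the map
   sending a point to the set of indices of the [A i] containing it. *)
Definition atom_index {I : finType} (A : I -> set T) (w : T) : {set I} :=
  [set i | w \in A i]%SET.

Lemma measurable_atom_index (I : finType) (A : I -> set T) (s : {set I}) :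
  (forall i, measurable (A i)) -> measurable (atom_index A @^-1` [set s]).
Proof.
move=> mA.
rewrite (_ : _ @^-1` _ = \bigcap_(i in [set: I]) (if i \in s then A i else ~` A i)).
  apply: fin_bigcap_measurable => // i _.
  by case: ifP => _ //; exact: measurableC.
apply/seteqP; split => w /=.
  by move=> <- i _; rewrite inE; case: ifPn => /=; rewrite ?in_setE ?notin_setE.
move=> H; apply/setP => i; rewrite inE; have := H i Logic.I.
by case: ifPn => _ /=; [rewrite -in_setE => ->|rewrite -notin_setE => /negPf ->].
Qed.

Lemma simple_atom_index (I : finType) (a : I -> R) (A : I -> set T) (w : T) :
  \sum_i a i * \1_(A i) w = \sum_(i in atom_index A w) a i.
Proof.
rewrite [RHS]big_mkcond /=; apply: eq_bigr => i _.
by rewrite inE indicE; case: (_ \in _); rewrite ?mulr1 ?mulr0.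
Qed.

(** Passage from overlapping sets to disjoint atoms: each [A i] is the union of the atoms whose
    index contains [i]. The coefficient of an atom is the value of the simple function on it, so
    almost sure inequalities can be checked term by term. *)
Lemma sum_atom_index (I : finType) (a : I -> R) (A : I -> set T) Q :
  M1f P Q -> (forall i, measurable (A i)) ->
  \sum_i a i * Q (A i) =
  \sum_(s : {set I}) (\sum_(i in s) a i) * Q (atom_index A @^-1` [set s]).
Proof.
move=> hQ mA.
under [RHS]eq_bigr do rewrite big_mkcond mulr_suml.
rewrite exchange_big /=; apply: eq_bigr => i _.
have -> : A i = atom_index A @^-1` [set` [pred s : {set I} | i \in s]].
  by apply/seteqP; split => w /=; rewrite !inE.
rewrite (M1f_preimage hQ); last by move=> s; exact: measurable_atom_index.
rewrite mulr_sumr [LHS]big_mkcond /=; apply: eq_bigr => s _.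
by rewrite inE; case: ifP; rewrite ?mul0r.
Qed.

Lemma M1f_sum_atom_index1 (I : finType) (A : I -> set T) Q :
  M1f P Q -> (forall i, measurable (A i)) ->
  \sum_(s : {set I}) Q (atom_index A @^-1` [set s]) = 1.
Proof.
move=> hQ mA; rewrite -(M1f_preimage hQ _ predT).
  by case: hQ => + _ _ _ => <-; congr Q; apply/seteqP; split.
by move=> s; exact: measurable_atom_index.
Qed.

(** An almost sure property that fails throughout an atom makes this atom [P]-null, hence [Q]-null
    by absolute continuity. *)
Lemma atom_null (I : finType) (A : I -> set T) Q (p : set T) (s : {set I}) :
  M1f P Q -> (forall i, measurable (A i)) -> {ae P, forall w, p w} ->
  (forall w, atom_index A w = s -> ~ p w) -> Q (atom_index A @^-1` [set s]) = 0.
Proof.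
move=> [_ _ _ Qac] mA pae H.
have mB := measurable_atom_index s mA.
apply: Qac => //.
apply/negligibleP => //.
by apply: negligibleS pae => w /= /H.
Qed.

(** In the sum over atoms, an atom with a negative coefficient is null, so no negative term
    survives. *)
Lemma sum_M1f_ge0 (I : finType) (a : I -> R) (A : I -> set T) Q :
  M1f P Q -> (forall i, measurable (A i)) ->
  {ae P, forall w, 0 <= \sum_i a i * \1_(A i) w} ->
  0 <= \sum_i a i * Q (A i).
Proof.
move=> hQ mA ae0; rewrite sum_atom_index//; apply: sumr_ge0 => s _.
have mB := measurable_atom_index s mA.
have [v0|v0] := leP 0 (\sum_(i in s) a i).
  by rewrite mulr_ge0//; case: hQ => _ + _ _; apply.
rewrite (atom_null hQ mA ae0) ?mulr0// => w ws /=.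
by rewrite simple_atom_index ws leNgt v0.
Qed.

Lemma le_sum_M1f (I J : finType) (a : I -> R) (A : I -> set T)
    (b : J -> R) (B : J -> set T) (c : R) Q :
  M1f P Q -> (forall i, measurable (A i)) -> (forall j, measurable (B j)) ->
  {ae P, forall w, \sum_i a i * \1_(A i) w <= \sum_j b j * \1_(B j) w + c} ->
  \sum_i a i * Q (A i) <= \sum_j b j * Q (B j) + c.
Proof.
move=> hQ mA mB ae0.
(* The difference of the two sides is a single simple function indexed by [I + J + unit]; the extra
   index carries the constant [c] on the whole space, of [Q]-mass 1. *)
pose K : finType := (I + J + unit)%type.
pose u (k : K) := match k with inl (inl i) => - a i | inl (inr j) => b j | inr _ => c end.
pose U (k : K) := match k with inl (inl i) => A i | inl (inr j) => B j | inr _ => setT end.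
have /= := @sum_M1f_ge0 K u U Q hQ _ _.
have E (f : set T -> R) : \sum_(k : K) u k * f (U k) =
   - (\sum_i a i * f (A i)) + \sum_j b j * f (B j) + c * f setT.
  rewrite big_sumType /= big_sumType /= -sumrN big_const card_unit /= addr0.
  by congr (_ + _ + _); apply: eq_bigr => i _; rewrite mulNr.
rewrite E; case: (hQ) => -> _ _ _; rewrite mulr1 => H.
rewrite -subr_ge0 addrC addrA; apply: H.
  by move=> [[i|j]|[]] //=.
apply: filterS ae0 => w.
by rewrite (E (fun A => \1_A w)) indicT mulr1 -subr_ge0 => H; lra.
Qed.

End finitely_additive.

(** * Expectation under a finitely additive probability *)

Section expectation.
Context {d : measure_display} {T : measurableType d} {R : realType}.
Variable P : probability T R.
Implicit Types (Q : set T -> R) (X : T -> R).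

(** The range [[-C, C]] is cut into slices of height [e], and [X] is rounded down to the bottom of
    its slice. *)
Lemma simple_approx X (e : R) : Linf P X -> 0 < e ->
  exists (n : nat) (a : 'I_n -> R) (A : 'I_n -> set T),
    [/\ forall i, measurable (A i),
        {ae P, forall w, \sum_i a i * \1_(A i) w <= X w} &
        {ae P, forall w, X w <= \sum_i a i * \1_(A i) w + e}].
Proof.
move=> [mX [C XC]] e0.
(* The successor provides the slice that contains the endpoint [C]. *)
pose n := (Num.truncn ((C + C) / e)).+1.
pose a (i : 'I_n) : R := i%:R * e - C.
pose A (i : 'I_n) := X @^-1` `[a i, a i + e[%classic.
exists n, a, A.
have key w : `|X w| <= C -> exists i : 'I_n,
    [/\ \sum_i a i * \1_(A i) w = a i, a i <= X w & X w <= a i + e].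
  rewrite ler_norml => /andP[X1 X2].
  have Y0 : 0 <= (X w + C) / e by apply: divr_ge0; [lra|exact: ltW].
  have kn : (Num.truncn ((X w + C) / e) < n)%N.
    by rewrite ltnS le_truncn// ler_pM2r ?invr_gt0// lerD2r.
  have AE (i : 'I_n) : (w \in A i) = (Num.truncn ((X w + C) / e) == i).
    rewrite truncn_eq// ler_pdivlMr// ltr_pdivrMr//.
    apply/idP/idP; rewrite inE /A /= in_itv /= /a -natr1 mulrDl => /andP[? ?];
      apply/andP; split; lra.
  exists (Ordinal kn); split.
  - rewrite (bigD1 (Ordinal kn))//= indicE AE eqxx mulr1 big1 ?addr0// => i ik.
    rewrite indicE AE (_ : _ == _ = false) ?mulr0//.
    by apply/negbTE; apply: contraNN ik => /eqP k; apply/eqP/val_inj.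
  - have := AE (Ordinal kn); rewrite eqxx => /set_mem.
    by rewrite /A /= in_itv /= => /andP[].
  - have := AE (Ordinal kn); rewrite eqxx => /set_mem.
    by rewrite /A /= in_itv /= => /andP[_ /ltW].
split.
- by move=> i; rewrite -[A i]setTI; apply: mX => //; exact: measurable_itv.
- by apply: filterS XC => w /key[i [-> ]].
- by apply: filterS XC => w /key[i [-> ]].
Qed.

Lemma sum_M1f_le_cst (I : finType) (a : I -> R) (A : I -> set T) (c : R) Q :
  M1f P Q -> (forall i, measurable (A i)) ->
  {ae P, forall w, \sum_i a i * \1_(A i) w <= c} -> \sum_i a i * Q (A i) <= c.
Proof.
move=> hQ mA ae0.
have := @le_sum_M1f _ _ _ P I 'I_0 a A (fun=> 0) (fun=> set0) c Q hQ mA.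
rewrite big_ord0 add0r; apply => //.
by apply: filterS ae0 => w; rewrite big_ord0 add0r.
Qed.

(** [sup] takes a default value on the empty set, so the set defining [EQ] must be inhabited;
    [simple_approx] supplies an element. *)
Lemma ge_EQ Q X (c : R) : Linf P X ->
  (forall n (a : 'I_n -> R) (A : 'I_n -> set T), (forall i, measurable (A i)) ->
     {ae P, forall w, \sum_i a i * \1_(A i) w <= X w} ->
     \sum_i a i * Q (A i) <= c) -> EQ P Q X <= c.
Proof.
move=> LX H; apply: ge_sup => [|_ [n [a [A [mA aeS ->]]]]]; last exact: H.
have [n [a [A [mA aeS _]]]] := simple_approx LX ltr01.
by exists (\sum_i a i * Q (A i)), n, a, A.
Qed.

Lemma le_EQ n (a : 'I_n -> R) (A : 'I_n -> set T) Q X :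
  Linf P X -> M1f P Q -> (forall i, measurable (A i)) ->
  {ae P, forall w, \sum_i a i * \1_(A i) w <= X w} ->
  \sum_i a i * Q (A i) <= EQ P Q X.
Proof.
move=> [mX [C XC]] hQ mA aeS; apply: ub_le_sup; last by exists n, a, A.
(* The essential bound of [X] is an upper bound of the set whose [sup] is [EQ]. *)
exists C => _ [m [b [B [mB aeB ->]]]].
apply: sum_M1f_le_cst => //.
by apply: filterS2 XC aeB => w /ler_normlW XC /le_trans; apply.
Qed.

(** Together with [le_EQ], it places [EQ] within [c] of the integral of a simple approximation from
    below. *)
Lemma EQ_le_simple n (a : 'I_n -> R) (A : 'I_n -> set T) (c : R) Q X :
  Linf P X -> M1f P Q -> (forall i, measurable (A i)) ->
  {ae P, forall w, X w <= \sum_i a i * \1_(A i) w + c} ->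
  EQ P Q X <= \sum_i a i * Q (A i) + c.
Proof.
move=> LX hQ mA aeX; apply: ge_EQ => // m b B mB aeB.
apply: (le_sum_M1f hQ) => //.
by apply: filterS2 aeX aeB => w wX /le_trans; apply.
Qed.

Lemma EQ_le_cst (c : R) Q X : Linf P X -> M1f P Q ->
  {ae P, forall w, X w <= c} -> EQ P Q X <= c.
Proof.
move=> LX hQ Xc; apply: ge_EQ => // n a A mA aeA.
apply: sum_M1f_le_cst => //.
by apply: filterS2 Xc aeA => w wX /le_trans; apply.
Qed.

Lemma Linf_indic (A : set T) : measurable A -> Linf P (\1_A).
Proof.
move=> mA; split; first exact: measurable_indic.
by exists 1; apply: aeW => w; rewrite indicE; case: (_ \in _); rewrite ?normr1 ?normr0.
Qed.

Lemma EQ_indic Q (A : set T) : M1f P Q -> measurable A -> EQ P Q (\1_A) = Q A.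
Proof.
move=> hQ mA; apply/eqP; rewrite eq_le; apply/andP; split.
  have := @EQ_le_simple 1 (fun=> 1) (fun=> A) 0 Q _ (Linf_indic mA) hQ (fun=> mA).
  rewrite !big_ord1 mul1r addr0; apply.
  by apply: aeW => w; rewrite big_ord1 mul1r addr0.
have := @le_EQ 1 (fun=> 1) (fun=> A) Q _ (Linf_indic mA) hQ (fun=> mA).
rewrite !big_ord1 mul1r; apply.
by apply: aeW => w; rewrite big_ord1 mul1r.
Qed.

End expectation.

(** * The layer-cake formula *)

Section layer_cake.
Context {d : measure_display} {T : measurableType d} {R : realType}.
Variable mu : {sigma_finite_measure set T -> \bar R}.
Local Open Scope ereal_scope.

(** Tonelli's theorem for the subgraph [0 <= x < Y w]: its sections are the intervals [[0, Y w[]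
    and, for [x >= 0], the events [x < Y w]. *)
Lemma ge0_integral_layer_cake (Y : T -> R) :
  measurable_fun setT Y -> (forall w, 0 <= Y w)%R ->
  \int[mu]_w (Y w)%:E =
  \int[@lebesgue_measure R]_(x in `[0%R, +oo[) mu [set w | (x < Y w)%R].
Proof.
move=> mY Y0.
pose A : set (T * R) := [set p | (0 <= p.2 < Y p.1)%R].
have mA : measurable A.
  rewrite (_ : A = (fun p => 0 <= p.2)%R @^-1` [set true] `&`
                   (fun p => p.2 < Y p.1)%R @^-1` [set true]); last first.
    by apply/seteqP; split => p /=; rewrite /A /= => /andP.
  apply: measurableI; rewrite -[X in measurable X]setTI.
    by apply: (measurable_fun_ler (measurable_cst _) measurable_snd).
  apply: (measurable_fun_ltr measurable_snd) => //.
  exact: (measurableT_comp mY).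
have := @indic_fubini_tonelli _ _ _ _ _ mu (@lebesgue_measure R) A mA.
rewrite indic_fubini_tonelli_FE// indic_fubini_tonelli_GE//.
rewrite [X in X = _ -> _](_ : _ = \int[mu]_w (Y w)%:E); last first.
  apply: eq_integral => w _ /=.
  rewrite (_ : xsection A w = `[0%R, Y w[%classic); last first.
    by apply/seteqP; split => x; rewrite /xsection /= inE /A /= in_itv.
  rewrite lebesgue_measure_itv/= lte_fin.
  have := Y0 w; rewrite le_eqVlt => /predU1P[<-|->].
    by rewrite ltxx.
  by rewrite sube0.
move=> ->; rewrite [in RHS]integral_mkcond.
apply: eq_integral => x _ /=; rewrite patchE; case: ifPn.
  rewrite inE /= in_itv /= andbT => x0; congr (mu _).
  by apply/seteqP; split => w; rewrite /ysection /= inE /A /= x0.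
rewrite notin_setE /= in_itv /= andbT => /negP x0.
rewrite (_ : ysection _ _ = set0) ?measure0//.
by apply/seteqP; split => w //; rewrite /ysection /= inE /A /= (negbTE x0).
Qed.

End layer_cake.

(** * Quantiles and the Rockafellar-Uryasev formula *)

Section value_at_risk.
Context {d : measure_display} {T : measurableType d} {R : realType}.
Variable P : probability T R.
Implicit Types (X : T -> R).
Local Open Scope ereal_scope.

Lemma ae_probability1 (A : set T) :
  measurable A -> {ae P, forall w, A w} -> P A = 1.
Proof.
move=> mA aeA; rewrite -(setCK A) probability_setC; last exact: measurableC.
rewrite (_ : P (~` A) = 0) ?sube0//.
by apply/negligibleP => //; exact: measurableC.
Qed.

Lemma measurable_le X (x : R) :
  measurable_fun setT X -> measurable [set w | (X w <= x)%R].
Proof.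
move=> mX; rewrite -[X in measurable X]setTI -(preimage_itvNyc X).
by apply: mX.
Qed.

Lemma measurable_lt X (x : R) :
  measurable_fun setT X -> measurable [set w | (X w < x)%R].
Proof.
move=> mX; rewrite -[X in measurable X]setTI -preimage_itvNyo.
by apply: mX.
Qed.

Lemma le_cdf X (x y : R) : measurable_fun setT X -> (x <= y)%R ->
  P [set w | (X w <= x)%R] <= P [set w | (X w <= y)%R].
Proof.
move=> mX xy; rewrite le_measure// ?inE; try exact: measurable_le.
by move=> w /= /le_trans; exact.
Qed.

Lemma cdf_ge_right X (x : R) (b : \bar R) : measurable_fun setT X ->
  (forall y, (x < y)%R -> b <= P [set w | (X w <= y)%R]) ->
  b <= P [set w | (X w <= x)%R].
Proof.
move=> mX H.
pose X' : {RV P >-> R} := mfun_Sub (mem_set mX).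
have E y : cdf X' y = P [set w | (X w <= y)%R].
  by rewrite /cdf set_itvNyc.
have := @cdf_right_continuous _ _ _ P X' x.
rewrite E => /cvge_to_ge; apply; near=> y; rewrite E; apply: H.
by near: y; exact: nbhs_right_gt.
Unshelve. all: by end_near. Qed.

(** By right continuity of the distribution function a finite infimum is attained; this makes [VaR]
    and the distribution function a Galois connection. *)
Lemma VaR_leP X (b x : R) : measurable_fun setT X ->
  (VaR P b X <= x%:E) = (b%:E <= P [set w | (X w <= x)%R]).
Proof.
move=> mX; apply/idP/idP => H; last first.
  by apply: ereal_inf_lbound; exists x.
apply: cdf_ge_right => // y xy.
have : VaR P b X < y%:E by apply: le_lt_trans H _; rewrite lte_fin.
move=> /ereal_inf_lt[_ [z /= bz <-]]; rewrite lte_fin => /ltW zy.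
exact: le_trans bz (le_cdf mX zy).
Qed.

(** The bound [0 < b] matters: at [b = 0] the infimum is over all reals and equals [-oo]. *)
Lemma VaR_bounded X (C b : R) : measurable_fun setT X ->
  {ae P, forall w, (`|X w| <= C)%R} -> (0 < b <= 1)%R ->
  (- C)%:E <= VaR P b X <= C%:E.
Proof.
move=> mX XC /andP[b0 b1]; rewrite VaR_leP//; apply/andP; split.
  apply: le_ereal_inf_tmp => _ [x /= bx <-]; rewrite lee_fin leNgt; apply/negP => xC.
  have : b%:E <= 0.
    apply: le_trans bx _; rewrite le_eqVlt (_ : P _ == 0)//; apply/eqP.
    apply/negligibleP; first exact: measurable_le.
    apply: negligibleS XC => w /= Xx /lerNnormlW; apply/negP; rewrite -ltNge.
    exact: le_lt_trans xC.
  by rewrite lee_fin leNgt b0.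
rewrite ae_probability1 ?lee_fin//; first exact: measurable_le.
by apply: filterS XC => w /ler_normlW.
Qed.

Lemma probability_gt X (x : R) : measurable_fun setT X ->
  P [set w | (x < X w)%R] = 1 - P [set w | (X w <= x)%R].
Proof.
move=> mX; rewrite -probability_setC; last exact: measurable_le.
by congr (P _); apply/seteqP; split => w /=; rewrite ltNge => /negP.
Qed.

(* Both integrals are computed by the layer-cake formula: for [x >= 0] the level
   set [{b | q + x < VaR b X}] is [`]F (q + x), 1]], where [F] is the cdf of X. *)
Lemma integral_VaR X (a q : R) : Linf P X -> (0 <= a < 1)%R ->
  P [set w | (X w < q)%R] <= a%:E -> a%:E <= P [set w | (X w <= q)%R] ->
  \int[@lebesgue_measure R]_(b in `]a, 1%R]) VaR P b X =
  ((1 - a) * q)%:E + \int[P]_w (Num.max (X w - q) 0)%:E.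
Proof.
move=> [mX [C XC]] /andP[a0 a1] qa aq.
pose D : set R := `]a, 1%R]%classic; have mD : measurable D by exact: measurable_itv.
pose V (b : R) : R := fine (VaR P b X).
have VE b : D b -> VaR P b X = (V b)%:E.
  rewrite /D /= in_itv /= => /andP[ab b1]; rewrite /V fineK//.
  have /andP[l u] : (- C)%:E <= VaR P b X <= C%:E.
    by apply: VaR_bounded => //; rewrite b1 (le_lt_trans a0 ab).
  by rewrite fin_numE -ltNye -ltey (lt_le_trans _ l) ?ltNyr// (le_lt_trans u) ?ltry.
have VC b : D b -> (V b <= C)%R.
  move=> Db; rewrite -lee_fin -VE//; move: Db; rewrite /D /= in_itv /= => /andP[ab b1].
  have /andP[] // : (- C)%:E <= VaR P b X <= C%:E.
  by apply: VaR_bounded => //; rewrite b1 (le_lt_trans a0 ab).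
have qV b : D b -> (q <= V b)%R.
  move=> Db; rewrite leNgt; apply/negP => Vq.
  have := VaR_leP b (V b) mX; rewrite -VE// lexx => /esym bV.
  move: Db; rewrite /D /= in_itv /= => /andP[ab _].
  have : b%:E <= a%:E; last by rewrite lee_fin leNgt ab.
  apply: (le_trans bV); apply: le_trans qa.
  rewrite le_measure ?inE//; [exact: measurable_le|exact: measurable_lt|].
  by move=> w /= /le_lt_trans; apply.
pose f (x : R) : R := fine (P [set w | (X w <= x)%R]).
have fE x : P [set w | (X w <= x)%R] = (f x)%:E.
  by rewrite fineK// fin_num_measure//; exact: measurable_le.
(* Extended by 0 outside [D], the excess of the quantile over [q] is nonnegative on the whole line,
   as the layer-cake formula requires. *)
pose Y : R -> R := (fun b => V b - q)%R \_ D.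
have Y0 b : (0 <= Y b)%R.
  rewrite /Y patchE; case: ifPn => // /set_mem /qV; by rewrite subr_ge0.
have level x : (0 <= x)%R -> [set b | (x < Y b)%R] = `]f (x + q)%R, 1%R]%classic.
  move=> x0; apply/seteqP; split => b /=; rewrite /Y patchE.
    case: ifPn => [/set_mem Db|]; last by rewrite ltNge x0.
    rewrite ltrBrDr ltNge -lee_fin -VE// VaR_leP// fE lee_fin -ltNge => fb.
    by move: Db; rewrite /D /= !in_itv /= fb => /andP[].
  rewrite in_itv /= => /andP[fb b1].
  have Db : D b.
    rewrite /D /= in_itv /= b1 andbT; apply: le_lt_trans fb.
    rewrite -lee_fin -fE; apply: (le_trans aq); apply: le_cdf => //.
    by rewrite lerDr.
  by rewrite mem_set// ltrBrDr ltNge -lee_fin -VE// VaR_leP// fE lee_fin -ltNge.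
(* The level sets just computed are intervals, which also settles measurability. *)
have mY : measurable_fun setT Y.
  apply: (measurability _ (RGenOInfty.measurableE R)).
  move=> _ [_ [x ->] <-]; rewrite setTI preimage_itvoy.
  have [x0|x0] := leP 0%R x; first by rewrite level//; exact: measurable_itv.
  rewrite (_ : [set _ | _] = setT)//; apply/seteqP; split => // b _ /=.
  exact: lt_le_trans (Y0 b).
transitivity (\int[@lebesgue_measure R]_(b in D) (q%:E + (Y b)%:E)).
  apply: eq_integral => b /[dup] bD /set_mem Db.
  by rewrite VE// /Y patchE bD -EFinD addrC subrK.
have lD : @lebesgue_measure R D = (1 - a)%:E.
  by rewrite lebesgue_measure_itv/= lte_fin a1.
have iq : (@lebesgue_measure R).-integrable D (EFin \o cst q).
  apply: measurable_bounded_integrable => //; first by rewrite [ltLHS]lD ltry.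
  exists `|q|%R; split; first exact: num_real.
  by move=> M qM b Db /=; exact: ltW.
have iY : (@lebesgue_measure R).-integrable D (EFin \o Y).
  apply: measurable_bounded_integrable => //; first by rewrite [ltLHS]lD ltry.
    exact: measurable_funTS.
  exists (C - q)%R; split; first exact: num_real.
  move=> M CM b Db; rewrite /= ger0_norm ?Y0// (le_trans _ (ltW CM))//.
  by rewrite /Y patchE mem_set// lerB ?VC.
rewrite integralD//.
congr (_ + _); first by rewrite integral_cst// (_ : _ D = (1 - a)%:E)// -EFinM [in RHS]mulrC.
transitivity (\int[@lebesgue_measure R]_b (Y b)%:E).
  rewrite [LHS]integral_mkcond; apply: eq_integral => b _.
  by rewrite patchE /= /Y patchE; case: (b \in D).
rewrite ge0_integral_layer_cake// ge0_integral_layer_cake//; last 2 first.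
- apply: measurable_maxr; last exact: measurable_cst.
  exact: measurable_funB.
- by move=> w; rewrite le_max lexx orbT.
apply: eq_integral => x /set_mem; rewrite /= in_itv /= andbT => x0.
rewrite level// lebesgue_measure_itv /= lte_fin.
rewrite (_ : [set w | _] = [set w | (x + q < X w)%R]); last first.
  apply/seteqP; split => w /=; rewrite lt_max [(x < 0)%R]ltNge x0 orbF ltrBrDr//.
(* Both level sets have measure [1 - f (x + q)]; in the remaining case the interval is empty and
   [f (x + q) = 1]. *)
rewrite probability_gt// fE; case: ltP => // f1.
have -> : f (x + q)%R = 1%R; last by rewrite subee.
by apply/eqP; rewrite eq_le f1 -lee_fin -fE probability_le1//; exact: measurable_le.
Qed.

Lemma ES_Rockafellar_Uryasev X (a q : R) : Linf P X -> (0 <= a < 1)%R ->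
  P [set w | (X w < q)%R] <= a%:E -> a%:E <= P [set w | (X w <= q)%R] ->
  ES P a X = q%:E + ((1 - a)^-1)%:E * \int[P]_w (Num.max (X w - q) 0)%:E.
Proof.
move=> LX a01 qa aq; rewrite /ES; case/andP: (a01) => _ a1.
rewrite a1 (integral_VaR LX a01 qa aq) muleDr// ?fin_num_adde_defr//.
by rewrite -EFinM mulKf// gt_eqF// subr_gt0.
Qed.

End value_at_risk.

(** * Integrals of simple functions under [P] *)

Section simple_integral.
Context {d : measure_display} {T : measurableType d} {R : realType}.
Variable P : probability T R.
Context {I : finType}.
Variables (c : I -> R) (A : I -> set T) (f : T -> R).
Hypothesis mA : forall i, measurable (A i).
Hypotheses (mf : measurable_fun setT f) (f0 : forall w, 0 <= f w).
Local Open Scope ereal_scope.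

Let S w := (\sum_i c i * \1_(A i) w)%R.

Lemma measurable_simple : measurable_fun setT S.
Proof.
rewrite /S; apply: measurable_sum => i; exact: measurable_funM.
Qed.

Lemma integral_simple :
  \int[P]_w (S w)%:E = (\sum_i c i * fine (P (A i)))%:E.
Proof.
pose g i w := ((c i)%:E * (\1_(A i) w)%:E).
have gi i : P.-integrable setT (g i).
  by apply: integrableZl => //; exact: integrable_indic.
transitivity (\int[P]_w \sum_i g i w).
  by apply: eq_integral => w _; rewrite /S -sumEFin; under eq_bigr do rewrite EFinM.
rewrite integral_sum// -sumEFin; apply: eq_bigr => i _; rewrite /g.
rewrite integralZl//; last exact: integrable_indic.
by rewrite integral_indic// setIT EFinM fineK// fin_num_measure.
Qed.

Lemma le_integral_simple : {ae P, forall w, (f w <= S w)%R} ->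
  \int[P]_w (f w)%:E <= (\sum_i c i * fine (P (A i)))%:E.
Proof.
move=> fS; rewrite -integral_simple.
(* [S] may be negative on a null set, so its positive part replaces it before nonnegative functions
   are compared. *)
rewrite (@ae_eq_integral _ _ _ P setT (fun w => (Num.max (S w) 0)%:E) (EFin \o S)) //.
- apply: ae_ge0_le_integral => //.
  + by move=> w _; rewrite lee_fin f0.
  + exact/measurable_EFinP.
  + by move=> w _; rewrite lee_fin le_max lexx orbT.
  + apply/measurable_EFinP; apply: measurable_maxr; last exact: measurable_cst.
    exact: measurable_simple.
  + by apply: filterS fS => w fSw _; rewrite lee_fin le_max fSw.
- exact/measurable_EFinP/measurable_simple.
- apply/measurable_EFinP; apply: measurable_maxr; last exact: measurable_cst.
  exact: measurable_simple.
- apply: filterS fS => w fSw _; congr EFin; apply/esym/max_idPl.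
  exact: le_trans fSw.
Qed.

Lemma simple_le_integral : (forall w, (0 <= S w)%R) ->
  {ae P, forall w, (S w <= f w)%R} ->
  (\sum_i c i * fine (P (A i)))%:E <= \int[P]_w (f w)%:E.
Proof.
move=> S0 Sf; rewrite -integral_simple; apply: ae_ge0_le_integral => //.
- by move=> w _; rewrite lee_fin ?f0 ?S0.
- exact/measurable_EFinP/measurable_simple.
- by move=> w _; rewrite lee_fin ?f0 ?S0.
- exact/measurable_EFinP.
- by apply: filterS Sf => w Sfw _; rewrite lee_fin.
Qed.

End simple_integral.

(** * Expected shortfall as an upper bound of the expectations *)

Section dual_representation.
Context {d : measure_display} {T : measurableType d} {R : realType}.
Variable P : probability T R.
Implicit Types (Q : set T -> R) (X : T -> R).
Local Open Scope ereal_scope.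

Lemma probability1_ae (A : set T) :
  measurable A -> 1 <= P A -> {ae P, forall w, A w}.
Proof.
move=> mA PA; exists (~` A); split => //; first exact: measurableC.
rewrite probability_setC// (_ : P A = 1) ?subee//.
by apply/eqP; rewrite eq_le PA andbT probability_le1.
Qed.

(** For [a > 0] the quantile is [VaR P a X], and the bound on [X < q] follows by continuity from
    below along the events [X <= q - 1/(n+1)]. For [a = 0], where [VaR] is [-oo], [- C] serves
    instead. *)
Lemma quantile_exists X (a : R) : Linf P X -> (0 <= a < 1)%R ->
  exists q : R, P [set w | (X w < q)%R] <= a%:E /\
                a%:E <= P [set w | (X w <= q)%R].
Proof.
move=> [mX [C XC]] /andP[a0 a1].
have [<-|a_neq0] := eqVneq 0%R a.
  exists (- C)%R; rewrite measure_ge0; split => //.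
  rewrite le_eqVlt (_ : P _ == 0)//; apply/eqP.
  apply/negligibleP; first exact: measurable_lt.
  by apply: negligibleS XC => w /= Xx /lerNnormlW; apply/negP; rewrite -ltNge.
have a01 : (0 < a <= 1)%R by rewrite lt_neqAle a_neq0 a0 ltW.
have /andP[l u] := VaR_bounded mX XC a01.
have VE : VaR P a X = (fine (VaR P a X))%:E.
  by rewrite fineK// fin_numE -ltNye -ltey (lt_le_trans _ l) ?ltNyr// (le_lt_trans u) ?ltry.
set q := fine _ in VE; exists q; split; last first.
  by rewrite -VaR_leP// VE.
pose F n := [set w | (X w <= q - n.+1%:R^-1)%R].
have FE : [set w | (X w < q)%R] = \bigcup_n F n.
  apply/seteqP; split => w /=.
    rewrite -subr_gt0 => Xq; have [n _ Hn] := near_infty_natSinv_lt (PosNum Xq).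
    exists n => //; rewrite /F /=; have := Hn n (leqnn n) => /= /ltW.
    by rewrite lerBrDr -lerBrDl.
  by move=> [n _]; rewrite /F /= => /le_lt_trans; apply; rewrite ltrBlDr ltrDl.
have mF n : measurable (F n) by exact: measurable_le.
have : P \o F @ \oo --> P (\bigcup_n F n).
  apply: nondecreasing_cvg_mu => //; first exact: bigcup_measurable.
  move=> m n mn; apply/subsetPset => w; rewrite /F /= => /le_trans; apply.
  by rewrite lerD2l lerN2 lef_pV2 ?posrE// ler_nat.
rewrite FE => /cvge_to_le; apply; apply: nearW => n /=.
rewrite leNgt; apply/negP => /ltW; rewrite -VaR_leP// VE lee_fin.
by rewrite leNgt ltrBlDr ltrDl invr_gt0 ltr0n.
Qed.

(** The bound is an extended real because [ES] is; [y = -oo] is impossible since some simple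
    function lies below [X]. *)
Lemma ge_EQ_ereal Q X (y : \bar R) : Linf P X ->
  (forall n (a : 'I_n -> R) (A : 'I_n -> set T), (forall i, measurable (A i)) ->
     {ae P, forall w, (\sum_i a i * \1_(A i) w <= X w)%R} ->
     (\sum_i a i * Q (A i))%:E <= y) -> (EQ P Q X)%:E <= y.
Proof.
move=> LX; case: y => [y| |] H; last 2 first.
- exact: leey.
- have [n [a [A [mA aeS _]]]] := simple_approx LX ltr01.
  by have := H n a A mA aeS.
- by rewrite lee_fin; apply: ge_EQ => // n a A mA /(H n a A mA); rewrite lee_fin.
Qed.

(** For [a = 1], every [x] with [P (X <= x) = 1] bounds [X] almost surely. For [a < 1], take a
    simple [S] below [X]: on each atom [S <= q + (S - q)^+], the mass [Q] is at most [k P], and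
    [(S - q)^+ <= (X - q)^+]. *)
Lemma EQ_le_ES X Q (a : R) : Linf P X -> M1f P Q -> (0 <= a <= 1)%R ->
  (forall A, measurable A -> ((1 - a) * Q A)%:E <= P A) ->
  (EQ P Q X)%:E <= ES P a X.
Proof.
move=> LX hQ /andP[a0]; have [mX _] := LX.
rewrite le_eqVlt => /predU1P[->{a a0} _|a1 QP].
  rewrite /ES ltxx; apply: le_ereal_inf_tmp => _ [x /= Px <-]; rewrite lee_fin.
  by apply: EQ_le_cst => //; apply: probability1_ae => //; exact: measurable_le.
have a01 : (0 <= a < 1)%R by rewrite a0.
have [q [qa aq]] := quantile_exists LX a01.
rewrite (ES_Rockafellar_Uryasev LX a01 qa aq); set k := (1 - a)^-1%R.
have k0 : (0 < k)%R by rewrite invr_gt0 subr_gt0.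
apply: ge_EQ_ereal => // n b A mA aeA.
pose v (s : {set 'I_n}) := (\sum_(i in s) b i)%R.
pose B (s : {set 'I_n}) := atom_index A @^-1` [set s].
have mB s : measurable (B s) by exact: measurable_atom_index.
have QB s : (0 <= Q (B s))%R by case: hQ => _ + _ _; exact.
have QPB s : (Q (B s) <= k * fine (P (B s)))%R.
  rewrite -ler_pdivrMl// invrK -lee_fin fineK ?QP//.
  by rewrite fin_num_measure.
have qE : (q = \sum_s q * Q (B s))%R.
  by rewrite -mulr_sumr (M1f_sum_atom_index1 hQ mA) mulr1.
apply: (@le_trans _ _ (q + k * \sum_s Num.max (v s - q) 0 * fine (P (B s)))%:E).
  rewrite lee_fin (sum_atom_index b hQ mA) [X in (_ <= X + _)%R]qE mulr_sumr.
  rewrite -big_split; apply: ler_sum => s _ /=; rewrite -/(B s) -/(v s).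
  rewrite -lerBlDl -mulrBl mulrCA.
  apply: (@le_trans _ _ (Num.max (v s - q) 0 * Q (B s))%R).
    by rewrite ler_wpM2r// le_max lexx.
  by rewrite ler_wpM2l// le_max lexx orbT.
rewrite EFinD EFinM leeD2l// lee_pmul2l//.
(* Exactly one atom contains [w], so the positive part can be taken atom by atom. *)
have SE w : (\sum_s Num.max (v s - q) 0 * \1_(B s) w =
             Num.max (\sum_i b i * \1_(A i) w - q) 0)%R.
  rewrite simple_atom_index (bigD1 (atom_index A w))//= indicE mem_set//.
  rewrite mulr1 big1 ?addr0// => s /eqP sA.
  by rewrite indicE memNset ?mulr0// => /esym.
apply: simple_le_integral => //.
- apply: measurable_maxr; last exact: measurable_cst.
  exact: measurable_funB.
- by move=> w; rewrite le_max lexx orbT.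
- by move=> w; rewrite SE le_max lexx orbT.
- apply: filterS aeA => w Sw; rewrite SE ge_max !le_max lexx orbT andbT.
  by rewrite lerB.
Qed.

End dual_representation.

(** * Near-optimal measures for expected shortfall *)

Section optimal_measure.
Context {d : measure_display} {T : measurableType d} {R : realType}.
Variable P : probability T R.
Implicit Types (Q : set T -> R) (X : T -> R).

Let p A := fine (P A).

(* The density of [mixture U V k l] with respect to [P] is [k] on [U] and [l]
   on [V]. *)
Definition mixture (U V : set T) (k l : R) : set T -> R :=
  fun A => k * p (A `&` U) + l * p (A `&` V).

Lemma M1f_mixture (U V : set T) (k l : R) : measurable U -> measurable V ->
  0 <= k -> 0 <= l -> k * p U + l * p V = 1 -> M1f P (mixture U V k l).
Proof.
move=> mU mV k0 l0 kl; rewrite /mixture; have [p1 p0 pU pac] := fine_M1f P.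
split => [|A mA|A B mA mB AB|A mA PA0].
- by rewrite !setTI.
- by rewrite addr_ge0// mulr_ge0// p0//; exact: measurableI.
- have H W : measurable W -> p ((A `|` B) `&` W) = p (A `&` W) + p (B `&` W).
    move=> mW; rewrite setIUl /p pU//; try exact: measurableI.
    by rewrite setIACA AB set0I.
  by rewrite !H//; ring.
- have H W : measurable W -> p (A `&` W) = 0.
    move=> mW; apply: pac; first exact: measurableI.
    by apply: (subset_measure0 _ mA) => //; exact: measurableI.
  by rewrite !H// !mulr0 addr0.
Qed.

Lemma ES1_le_EQ X (e : R) : Linf P X -> 0 < e ->
  exists Q, M1f P Q /\ (ES P 1 X <= (EQ P Q X + e)%:E)%E.
Proof.
move=> LX e0; have [mX [C XC]] := LX.
have /andP[l u] : ((- C)%:E <= VaR P 1 X <= C%:E)%E.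
  by apply: VaR_bounded => //; rewrite ltr01 lexx.
have VE : VaR P 1 X = (fine (VaR P 1 X))%:E.
  by rewrite fineK// fin_numE -ltNye -ltey (lt_le_trans _ l) ?ltNyr// (le_lt_trans u) ?ltry.
rewrite /ES ltxx VE; set m := fine _ in VE *.
pose U := [set w | m - e < X w].
have mU : measurable U.
  by rewrite /U -[X in measurable X]setTI -preimage_itvoy; exact: mX.
have pU0 : 0 < p U.
  (* If [U] were null, [m - e] would already be an essential upper bound of [X], below the least one
     [m]. *)
  rewrite lt_neqAle [X in _ && X]fine_ge0// andbT; apply/eqP => pU0.
  have : (VaR P 1 X <= (m - e)%:E)%E.
    rewrite VaR_leP//; have := probability_gt P (m - e) mX.
    rewrite -/U -[P U]fineK ?fin_num_measure// -/(p U) -pU0.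
    rewrite -[P [set w | _]]fineK ?fin_num_measure//; last exact: measurable_le.
    by move=> [] /eqP; rewrite eq_sym subr_eq0 => /eqP ->.
  by rewrite VE lee_fin leNgt ltrBlDl ltrDr e0.
pose Q := mixture U set0 (p U)^-1 0.
have hQ : M1f P Q.
  apply: M1f_mixture => //; first by rewrite invr_ge0 ltW.
  by rewrite mul0r addr0 mulVf// gt_eqF.
have QE A : Q A = (p U)^-1 * p (A `&` U) by rewrite /Q /mixture mul0r addr0.
exists Q; split => //; rewrite lee_fin -lerBlDr.
(* A simple minorant of [X]: [m - e] on [U] and [- C] elsewhere, where [Q] has no mass. *)
pose a (i : 'I_2) : R := if i == ord0 then m - e else - C.
pose A (i : 'I_2) := if i == ord0 then U else ~` U.
have := @le_EQ _ _ _ P 2 a A Q X LX hQ.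
rewrite !big_ord_recl big_ord0 /a /A /= !QE setICl setIid mulVf ?gt_eqF//.
rewrite {2}/p measure0 !mulr0 mulr1 !addr0; apply.
  by move=> i; case: ifP => // _; exact: measurableC.
apply: filterS XC => w /lerNnormlW CX.
rewrite !big_ord_recl big_ord0 /= addr0 !indicE in_setC.
have [wU|wU] := boolP (w \in U); rewrite /= ?mulr1 ?mulr0 ?addr0 ?add0r//.
by move/set_mem: wU => /ltW.
Qed.

(** The quantile inequalities read [P (X > q) <= 1 - a <= P (X >= q)]. Hence density [k] on [U] uses
    at most mass 1, and [V] can hold the rest with a density [l <= k]. The error [e] comes only from
    replacing [X] by a simple function. *)
Lemma ES_lt1_le_EQ X (a e : R) : Linf P X -> 0 <= a < 1 -> 0 < e ->
  exists Q, [/\ M1f P Q,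
    (forall A, measurable A -> (((1 - a) * Q A)%:E <= P A)%E) &
    (ES P a X <= (EQ P Q X + e)%:E)%E].
Proof.
move=> LX a01 e0; have [mX _] := LX.
have [q [qa aq]] := quantile_exists LX a01.
have [p1 p0 pU _] := fine_M1f P; rewrite -/p in p1 p0 pU.
have a1 : 0 < 1 - a by rewrite subr_gt0; case/andP: a01.
pose k := (1 - a)^-1; have k0 : 0 < k by rewrite invr_gt0.
pose U := [set w | q < X w]; pose V := [set w | X w <= q] `&` [set w | q <= X w].
have mge : measurable [set w | q <= X w].
  by rewrite -[X in measurable X]setTI -preimage_itvcy; exact: mX.
have mU : measurable U.
  by rewrite /U -[X in measurable X]setTI -preimage_itvoy; exact: mX.
have mV : measurable V by apply: measurableI => //; exact: measurable_le.
have UV0 : U `&` V = set0.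
  apply/seteqP; split => w //=; rewrite /U /V /= => -[qX [Xq _]].
  by move: qX; rewrite ltNge Xq.
have pUle : p U <= 1 - a.
  rewrite -lee_fin /p fineK ?fin_num_measure// /U probability_gt//.
  by rewrite EFinB leeB.
have pUVge : 1 - a <= p U + p V.
  rewrite -pU//.
  have -> : U `|` V = ~` [set w | X w < q].
    apply/seteqP; split => w; rewrite /U /V /=.
      by move=> [/ltW|[_]] qX; apply/negP; rewrite -leNgt.
    by move/negP; rewrite -leNgt => qX; have [?|?] := ltP q (X w); [left|right].
  rewrite -lee_fin /p fineK ?fin_num_measure//; last exact/measurableC/measurable_lt.
  rewrite probability_setC; last exact: measurable_lt.
  by rewrite EFinB leeB.
have kU : k * p U <= 1 by rewrite mulrC ler_pdivrMr// mul1r.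
(* When [P V = 0], no mass is left for [V], and [x / 0 = 0] gives [l = 0]. *)
pose l := (1 - k * p U) / p V.
have pV0 : 0 <= p V by exact: p0.
have lV : l * p V = 1 - k * p U.
  have [pV|pV] := eqVneq (p V) 0; last by rewrite /l divfK.
  rewrite /l pV mulr0; apply/esym/eqP; rewrite subr_eq0 eq_sym.
  move: pUVge; rewrite pV addr0 => pUge.
  have -> : p U = 1 - a by apply/eqP; rewrite eq_le pUle.
  by rewrite mulVf// gt_eqF.
have l0 : 0 <= l by rewrite divr_ge0// subr_ge0.
have lk : l <= k.
  have [pV|pV] := eqVneq (p V) 0; first by rewrite /l pV invr0 mulr0 ltW.
  rewrite ler_pdivrMr; last by rewrite lt_neqAle eq_sym pV.
  rewrite lerBlDl -mulrDr -(mulVf (lt0r_neq0 a1)).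
  by rewrite ler_pM2l.
pose Q := mixture U V k l.
have hQ : M1f P Q by apply: M1f_mixture => //; [exact: ltW|rewrite lV; ring].
exists Q; split => // [A mA|].
  have mAU := measurableI _ _ mA mU; have mAV := measurableI _ _ mA mV.
  (* [U] and [V] are disjoint, so together with [l <= k] this yields [Q A <= k * p A]. *)
  have Ale : p (A `&` U) + p (A `&` V) <= p A.
    rewrite -pU//; last by rewrite setIACA UV0 setI0.
    rewrite /p fine_le ?fin_num_measure//; try exact: measurableU.
    apply: le_measure; rewrite ?inE//; first exact: measurableU.
    by rewrite -setIUr; exact: subIsetl.
  rewrite -[leRHS]fineK ?fin_num_measure// lee_fin -/(p A); apply: le_trans Ale.
  rewrite mulrC -ler_pdivlMr// -/k mulrC mulrDr lerD2l.
  by rewrite ler_wpM2r// p0.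
rewrite (ES_Rockafellar_Uryasev LX a01 qa aq) -/k.
have [n [b [A [mA aeS aeX]]]] := simple_approx LX e0.
have QEQ := le_EQ LX hQ mA aeS.
have mAU i := measurableI _ _ (mA i) mU; have mAV i := measurableI _ _ (mA i) mV.
have HU : (\int[P]_w (Num.max (X w - q) 0)%:E <=
   (\sum_i b i * p (A i `&` U) + (e - q) * p U)%:E)%E.
  (* On [U], [X - q] is at most the simple function plus [e - q]; the extra index carries this
     constant. *)
  pose c (i : 'I_n + unit) := if i is inl i then b i else e - q.
  pose D (i : 'I_n + unit) := if i is inl i then A i `&` U else U.
  have := @le_integral_simple _ _ _ P ('I_n + unit)%type c D
    (fun w => Num.max (X w - q) 0).
  have E (f : set T -> R) : \sum_i c i * f (D i) =
      \sum_i b i * f (A i `&` U) + (e - q) * f U.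
    by rewrite big_sumType /= big_const card_unit /= addr0.
  rewrite (E p); apply.
  - by case.
  - apply: measurable_maxr; last exact: measurable_cst.
    exact: measurable_funB.
  - by move=> w; rewrite le_max lexx orbT.
  - apply: filterS aeX => w; rewrite (E (fun A => \1_A w)) => Xe.
    under eq_bigr do rewrite indicI /=.
    rewrite !indicE.
    have [/set_mem wU|/negP wU] := boolP (w \in U).
      under eq_bigr do rewrite mulr1.
      rewrite mulr1 ge_max; move: wU; rewrite /U /= => ?.
      by apply/andP; split; [lra|apply: le_trans (_ : X w - q <= _); lra].
    under eq_bigr do rewrite mulr0 mulr0.
    rewrite sumr_const mul0rn mulr0 addr0 ge_max lexx andbT subr_le0 leNgt.
    by apply/negP => qX; apply: wU; rewrite inE.
(* On [V], [X = q], so the simple function is at least [q - e] there. *)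
have HV : (q - e) * p V <= \sum_i b i * p (A i `&` V).
  have := @le_sum_M1f _ _ _ P unit 'I_n (fun=> q - e) (fun=> V) b
    (fun i => A i `&` V) 0 p (fine_M1f P) (fun=> mV) mAV.
  rewrite big_const card_unit /= !addr0; apply.
  apply: filterS aeX => w Xe.
  rewrite big_const card_unit /= !addr0.
  under [leRHS]eq_bigr do rewrite indicI /=.
  rewrite !indicE.
  have [/set_mem wV|wV] := boolP (w \in V); last first.
    by under [leRHS]eq_bigr do rewrite mulr0 mulr0; rewrite sumr_const mul0rn mulr0.
  under [leRHS]eq_bigr do rewrite mulr1.
  by move: wV => [/= _ qX]; rewrite mulr1; lra.
apply: (@le_trans _ _ (q%:E + k%:E *
   (\sum_i b i * p (A i `&` U) + (e - q) * p U)%:E)%E).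
  by rewrite leeD2l// lee_pmul2l.
rewrite -EFinM -EFinD lee_fin.
have QE : \sum_i b i * Q (A i) =
    k * (\sum_i b i * p (A i `&` U)) + l * (\sum_i b i * p (A i `&` V)).
  rewrite !mulr_sumr -big_split; apply: eq_bigr => i _.
  by rewrite /Q /mixture /=; ring.
(* By [lV], the multiples of [k * p U] cancel between the contributions of [U] and [V], leaving the
   error [e]. *)
have := ler_wpM2l l0 HV; move: QEQ; rewrite QE.
have -> : l * ((q - e) * p V) = (q - e) * (1 - k * p U) by rewrite -lV; ring.
set s1 := \sum_i _; set s2 := \sum_i _.
have -> : k * (s1 + (e - q) * p U) = k * s1 + (e - q) * (k * p U) by ring.
have -> : (q - e) * (1 - k * p U) = q - e + (e - q) * (k * p U) by ring.
by move=> ? ?; lra.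
Qed.

Lemma ES_le_EQ X (a e : R) : Linf P X -> 0 <= a <= 1 -> 0 < e ->
  exists Q, [/\ M1f P Q,
    (forall A, measurable A -> (((1 - a) * Q A)%:E <= P A)%E) &
    (ES P a X <= (EQ P Q X + e)%:E)%E].
Proof.
move=> LX /andP[a0]; rewrite le_eqVlt => /predU1P[->{a a0}|a1] e0.
  have [Q [hQ ESQ]] := ES1_le_EQ LX e0; exists Q; split => // A mA.
  by rewrite subrr mul0r.
by apply: ES_lt1_le_EQ => //; rewrite a0.
Qed.

End optimal_measure.

(** * The functional R and the robust representation *)

Section robust_representation.
Context {d : measure_display} {T : measurableType d} {R : realType}.
Variables (P : probability T R) (Lam : R -> R).
Hypothesis Lam01 : forall x, 0 <= Lam x <= 1.
Hypothesis Lam_decr : {homo Lam : x y / x <= y >-> y <= x}.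
Implicit Types (Q : set T -> R) (X : T -> R).

Lemma Rcond_le Q (x y : R) : M1f P Q -> x <= y -> Rcond P Lam Q y ->
  Rcond P Lam Q x.
Proof.
move=> [_ Q0 _ _] xy Ry A mA; apply: le_trans (Ry A mA).
by rewrite lee_fin ler_wpM2r ?Q0// lerD2l lerN2 Lam_decr.
Qed.

(** [P] itself admits every level, which keeps the supremum over [Q] away from [-oo]. *)
Lemma Rcond_fine (x : R) : Rcond P Lam (fun A => fine (P A)) x.
Proof.
move=> A mA; rewrite -[leRHS]fineK ?fin_num_measure// lee_fin.
rewrite ler_piMl ?fine_ge0// lerBlDr lerDl.
by case/andP: (Lam01 x).
Qed.

Lemma Rfun_le t Q : (Rfun P Lam t Q <= t%:E)%E.
Proof.
by apply: ge_ereal_sup => _ [x _ <-]; rewrite lee_fin ge_min lexx.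
Qed.

Lemma Rfun_ge t Q (x : R) : Rcond P Lam Q x ->
  ((Num.min t x)%:E <= Rfun P Lam t Q)%E.
Proof. by move=> Rx; apply: ereal_sup_ubound; exists x. Qed.

Lemma Rfun_homo t1 t2 Q : t1 <= t2 -> (Rfun P Lam t1 Q <= Rfun P Lam t2 Q)%E.
Proof.
move=> t12; apply: ge_ereal_sup => _ [x Rx <-].
apply: le_trans (Rfun_ge t2 Rx).
by rewrite lee_fin le_min !ge_min t12 lexx orbT.
Qed.

(** Each map [t -> min(t, z)] is increasing and 1-Lipschitz, and this passes to the supremum over
    [z]. *)
Lemma Rfun_lipschitz t1 t2 Q : t2 <= t1 ->
  (Rfun P Lam t1 Q - Rfun P Lam t2 Q <= (t1 - t2)%:E)%E.
Proof.
move=> t21; have [[x Rx]|nR] := pselect (exists x, Rcond P Lam Q x).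
  have R2 : Rfun P Lam t2 Q \is a fin_num.
    rewrite fin_numE -ltNye -ltey (le_lt_trans (Rfun_le _ _)) ?ltry// andbT.
    exact: lt_le_trans (ltNyr _) (Rfun_ge t2 Rx).
  rewrite leeBlDr//; apply: ge_ereal_sup => _ [z Rz <-].
  apply: (@le_trans _ _ ((t1 - t2) + Num.min t2 z)%:E); last first.
    by rewrite EFinD leeD2l// Rfun_ge.
  by rewrite lee_fin /Num.min; case: ifP; case: ifP => ? ?; lra.
(* Without admissible levels both values are [-oo], and [-oo - -oo] is [-oo] by convention. *)
have RE t : Rfun P Lam t Q = -oo%E.
  rewrite /Rfun (_ : [set x | _] = set0) ?image_set0 ?ereal_sup0//.
  by apply/seteqP; split => // x Rx; apply: nR; exists x.
by rewrite !RE leNye.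
Qed.

(** Since [R(t, Q) <= t], letting [t] decrease gives the same infimum for every [Q]. *)
Lemma ereal_inf_Rfun Q :
  ereal_inf [set Rfun P Lam t Q | t in [set: R]] = -oo%E.
Proof.
apply: eq_ninfty => r; apply: le_trans (Rfun_le r Q).
by apply: ereal_inf_lbound; exists r.
Qed.

(** Admissibility of a fixed level is affine in [Q] and levels form a down-set, so the smaller of
    two levels admissible for [Q1] and [Q2] is admissible for the mixture. *)
Lemma quasi_concave_Rfun : quasi_concave_RM1f P (Rfun P Lam).
Proof.
move=> t1 t2 l Q1 Q2 h1 h2 /andP[l0 l1]; rewrite leNgt lt_min; apply/negP.
case/andP => /ereal_sup_gt[_ [x1 R1 <-] lt1] /ereal_sup_gt[_ [x2 R2 <-] lt2].
pose z := Num.min x1 x2.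
have Rz : Rcond P Lam (mixQ l Q1 Q2) z.
  move=> A mA.
  have := Rcond_le h1 (_ : z <= x1) R1 mA; rewrite /z ge_min lexx => /(_ isT).
  have := Rcond_le h2 (_ : z <= x2) R2 mA; rewrite /z ge_min lexx orbT => /(_ isT).
  rewrite /mixQ -[P A]fineK ?fin_num_measure// !lee_fin => H2 H1.
  have l1' : 0 <= 1 - l by rewrite subr_ge0.
  by have := ler_wpM2l l0 H1; have := ler_wpM2l l1' H2; lra.
have := Rfun_ge (l * t1 + (1 - l) * t2) Rz.
apply/negP; rewrite -ltNge.
pose m := Num.min (Num.min t1 x1) (Num.min t2 x2).
apply: (@lt_le_trans _ _ m%:E); first by rewrite EFin_min lt_min lt1.
rewrite lee_fin le_min /z le_min; apply/andP; split; last first.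
  by rewrite /m !ge_min !lexx !orbT.
have m1 : 0 <= t1 - m by rewrite subr_ge0 /m !ge_min lexx.
have m2 : 0 <= t2 - m by rewrite subr_ge0 /m !ge_min lexx !orbT.
rewrite -subr_ge0.
have -> : l * t1 + (1 - l) * t2 - m = l * (t1 - m) + (1 - l) * (t2 - m) by ring.
by rewrite addr_ge0// mulr_ge0// subr_ge0.
Qed.

Lemma usc_Rfun : usc_RM1f P (Rfun P Lam).
Proof.
move=> t Q c hQ Rc; have [tc|ct] := ltP t c.
  (* Here [R(s, Q') <= s < c] for [s] near [t], so no test variable is needed. *)
  exists (c - t); split; first by rewrite subr_gt0.
  exists 0%N, (fun=> \1_set0); split; first by case.
  move=> s Q' _ st _; apply: le_lt_trans (Rfun_le _ _) _.
  by rewrite lte_fin; move: st; rewrite ltr_norml => /andP[_]; rewrite ltrD2r.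
(* If all levels below [c] were admissible, [c <= t] would give [R(t, Q) >= c]. *)
have [x [xc nRx]] : exists x, x < c /\ ~ Rcond P Lam Q x.
  apply: contrapT => H; move: Rc; apply/negP; rewrite -leNgt.
  apply/lee_subgt0Pr => e e0; rewrite -EFinB.
  have Rce : Rcond P Lam Q (c - e).
    by apply: contrapT => ?; apply: H; exists (c - e); rewrite ltrBlDr ltrDl.
  apply: le_trans (Rfun_ge t Rce); rewrite lee_fin le_min lexx andbT.
  by apply: le_trans ct; rewrite lerBlDr lerDl ltW.
move: nRx => /existsNP[A /not_implyP[mA]].
rewrite -[P A]fineK ?fin_num_measure// lee_fin => /negP; rewrite -ltNge -subr_gt0.
(* [e] is the amount by which [A] violates the condition at level [x]; any [Q'] with [Q' A] within
   [e] of [Q A] still violates it. *)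
set e := _ - _ => e0; exists e; split => //.
exists 1%N, (fun=> \1_A); split; first by move=> _; exact: Linf_indic.
move=> s Q' hQ' _ /(_ ord0); rewrite !EQ_indic// => Qe.
apply: (@le_lt_trans _ _ x%:E); last by rewrite lte_fin.
apply: ge_ereal_sup => _ [z Rz <-]; rewrite lee_fin ge_min; apply/orP; right.
rewrite leNgt; apply/negP => /ltW xz.
have := Rcond_le hQ' xz Rz mA.
rewrite -[P A]fineK ?fin_num_measure// lee_fin leNgt => /negP; apply.
have [L0 L1] := andP (Lam01 x).
have {}Qe : 0 < Q' A - Q A + e.
  by move: Qe; rewrite ltr_norml => /andP[Qe _]; lra.
rewrite -subr_gt0.
(* The violation by [Q'] is a convex combination, with weight [Lam x], of two positive numbers. *)
have -> : (1 - Lam x) * Q' A - fine (P A) =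
    (1 - Lam x) * (Q' A - Q A + e) + Lam x * e by rewrite /e; ring.
move: L0; rewrite le_eqVlt => /predU1P[<-|L0].
  by rewrite subr0 mul1r mul0r addr0.
by rewrite ltr_wpDl ?mulr_ge0 ?mulr_gt0 ?subr_ge0// ltW.
Qed.

(** Two suprema are interchanged: for fixed [x], the measures admitting level [x] are exactly those
    in the dual representation of [ES] at [Lam x], up to an arbitrary [e]. *)
Lemma ES_Lam_dual X : Linf P X ->
  ES_Lam P Lam X = ereal_sup [set Rfun P Lam (EQ P Q X) Q | Q in [set Q | M1f P Q]].
Proof.
move=> LX; apply/eqP; rewrite eq_le; apply/andP; split.
  apply: ge_ereal_sup => _ [x _ <-]; apply/lee_addgt0Pr => e e0.
  have [Q [hQ QP ESQ]] := ES_le_EQ LX (Lam01 x) e0.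
  apply: (@le_trans _ _ (Num.min (EQ P Q X) x + e)%:E).
    apply: (@le_trans _ _ (Order.min (EQ P Q X + e)%:E x%:E)).
      by rewrite le_min !ge_min ESQ lexx orbT.
    rewrite -EFin_min lee_fin /Num.min; case: ifP; case: ifP => ? ?; lra.
  rewrite EFinD leeD2r//; apply: le_trans (Rfun_ge (EQ P Q X) QP) _.
  by apply: ereal_sup_ubound; exists Q.
apply: ge_ereal_sup => _ [Q hQ <-]; apply: ge_ereal_sup => _ [x Rx <-].
apply: le_ereal_sup_tmp; exists (Order.min (ES P (Lam x) X) x%:E); first by exists x.
by rewrite EFin_min le_min !ge_min lexx orbT andbT EQ_le_ES.
Qed.

End robust_representation.

(** * Attainment of the supremum by weak* compactness *)

Lemma ultra_fmap (S U : Type) (f : S -> U) (F : set_system S) :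
  UltraFilter F -> UltraFilter (f @ F).
Proof.
move=> UF; split; first exact: fmap_proper_filter.
move=> G PG FG; apply/seteqP; split => // A GA.
have [//|FnA] := in_ultra_setVsetC (f @^-1` A) UF.
have GnA : G (~` A) by exact: FG.
by have [] := @filter_not_empty _ G PG; rewrite -(setICr A); exact: filterI.
Qed.

Section attainment.
Context {d : measure_display} {T : measurableType d} {R : realType}.
Variables (P : probability T R) (Lam : R -> R).
Hypothesis Lam01 : forall x, 0 <= Lam x <= 1.
Hypothesis Lam_decr : {homo Lam : x y / x <= y >-> y <= x}.
Implicit Types (Q : set T -> R) (X : T -> R).

(** Values lie in the compact [[0, 1]], so they converge along the ultrafilter. The conditions in
    [M1f] are equalities and weak inequalities between finitely many values, hence survive in the
    limit. *)
Lemma M1f_ultralimit (U : set_system nat) (Qn : nat -> set T -> R) :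
  UltraFilter U -> (forall n, M1f P (Qn n)) ->
  exists Q, M1f P Q /\
    forall A, measurable A -> Qn n A @[n --> U] --> Q A.
Proof.
move=> UU hQn; have PU : ProperFilter U by exact: ultra_proper.
pose Q A := lim (Qn n A @[n --> U]).
have Qcvg A : measurable A -> Qn n A @[n --> U] --> Q A.
  move=> mA; have UA := ultra_fmap (fun n => Qn n A) UU.
  have := @segment_compact R 0 1; rewrite compact_ultra.
  move=> /(_ ((fun n => Qn n A) @ U) UA) [|l [_ Al]].
    apply: (@filterE _ U) => n; rewrite /= in_itv /= (M1f_le1 (hQn n) mA) andbT.
    by case: (hQn n) => _ + _ _; apply.
  exact: cvgP Al.
exists Q; split => //; split.
- apply: (cvg_unique _ (Qcvg _ measurableT)); first exact: Rhausdorff.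
  apply: cvg_near_cst; apply: filterE => n /=; by case: (hQn n).
- move=> A mA; apply: (cvgr_to_ge (Qcvg A mA)); apply: filterE => n.
  by case: (hQn n) => _ + _ _; exact.
- move=> A B mA mB AB; apply: (cvg_unique _ (Qcvg _ (measurableU _ _ mA mB))).
    exact: Rhausdorff.
  rewrite (_ : (fun n => _) = (fun n => Qn n A) + (fun n => Qn n B)).
    exact: cvgD (Qcvg A mA) (Qcvg B mB).
  by apply/funext => n /=; case: (hQn n) => _ _ + _; exact.
- move=> A mA PA0; apply: (cvg_unique _ (Qcvg _ mA)); first exact: Rhausdorff.
  apply: cvg_near_cst; apply: filterE => n /=.
  by case: (hQn n) => _ _ _; exact.
Qed.

Lemma sup_Rfun_attained X : Linf P X -> exists Q, M1f P Q /\
  ereal_sup [set Rfun P Lam (EQ P Q X) Q | Q in [set Q | M1f P Q]] =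
  Rfun P Lam (EQ P Q X) Q.
Proof.
move=> LX; have [mX [C XC]] := LX; set E := [set Rfun _ _ _ _ | _ in _].
have [s sE] : exists s : R, ereal_sup E = s%:E.
  exists (fine (ereal_sup E)); rewrite fineK// fin_numE -ltNye -ltey.
  apply/andP; split.
    pose p A := fine (P A); apply: (@lt_le_trans _ _ (EQ P p X)%:E).
      exact: ltNyr.
    apply: (@le_trans _ _ (Rfun P Lam (EQ P p X) p)).
      have := Rfun_ge (EQ P p X) (Rcond_fine P Lam01 (EQ P p X)).
      by rewrite minxx.
    by apply: ereal_sup_ubound; exists p => //; exact: fine_M1f.
  apply: (@le_lt_trans _ _ C%:E); last exact: ltry.
  apply: ge_ereal_sup => _ [Q hQ <-]; apply: le_trans (Rfun_le _ _ _ _) _.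
  rewrite lee_fin; apply: EQ_le_cst => //.
  by apply: filterS XC => w /ler_normlW.
(* A value of R above [s - 1/(n+1)] forces both the expectation and some admissible level above it;
   [Rcond_le] lowers that level. *)
have [Qn hQn] : {Qn : nat -> set T -> R & forall n, [/\ M1f P (Qn n),
    Rcond P Lam (Qn n) (s - n.+1%:R^-1) & s - n.+1%:R^-1 <= EQ P (Qn n) X]}.
  apply: (@choice _ _ (fun n Q => [/\ M1f P Q,
    Rcond P Lam Q (s - n.+1%:R^-1) & s - n.+1%:R^-1 <= EQ P Q X])) => n.
  have : ((s - n.+1%:R^-1)%:E < ereal_sup E)%E.
    by rewrite sE lte_fin ltrBlDr ltrDl.
  move=> /ereal_sup_gt[_ [Q hQ <-]] /ereal_sup_gt[_ [x Rx <-]].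
  rewrite lte_fin lt_min => /andP[/ltW sQ /ltW sx].
  by exists Q; split => //; exact: Rcond_le sx Rx.
(* [U] refines the filter at infinity, so the errors [1/(n+1)] vanish along it. *)
have [U [UU ooU]] := @ultraFilterLemma nat (nbhs \oo) _.
have PU : ProperFilter U by exact: ultra_proper.
have [Q [hQ Qcvg]] := M1f_ultralimit UU (fun n => let: And3 h _ _ := hQn n in h).
have near_s (e : R) : 0 < e -> \forall n \near U, n.+1%:R^-1 < e.
  by move=> e0; apply: ooU; exact: (near_infty_natSinv_lt (PosNum e0)).
have sQ : s <= EQ P Q X.
  apply/ler_addgt0Pr => e e0; have e20 : 0 < e / 2 by rewrite divr_gt0.
  (* Convergence is known on events only. A simple function within [e / 2] of [X] transfers it to
     expectations; the other [e / 2] absorbs [1/(m+1)]. *)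
  have [n [b [A [mA aeS aeX]]]] := simple_approx LX e20.
  have : s - e <= \sum_i b i * Q (A i); last first.
    by have := le_EQ LX hQ mA aeS; lra.
  have : \sum_i b i * Qn m (A i) @[m --> U] --> \sum_i b i * Q (A i).
    apply: cvg_big => [|i _]; first exact: add_continuous.
    exact: cvgM (cvg_cst _) (Qcvg _ (mA i)).
  move/cvgr_to_ge; apply; apply: filterS (near_s _ e20) => m /= me.
  have [hm _ sm] := hQn m; have := EQ_le_simple LX hm mA aeX.
  by move: (m.+1%:R^-1) me sm => r; lra.
exists Q; split => //; apply/eqP; rewrite eq_le; apply/andP; split; last first.
  by apply: ereal_sup_ubound; exists Q.
rewrite sE; apply/lee_subgt0Pr => e e0; rewrite -EFinB.
(* R is a supremum over levels, so it is enough to admit every [s - e]. Along [U] this level is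
   eventually below that of [Qn m], and the condition at a fixed level is closed in [Q]. *)
have Rse : Rcond P Lam Q (s - e).
  move=> A mA; rewrite -[leRHS]fineK ?fin_num_measure// lee_fin.
  apply: (cvgr_to_le (cvgM (cvg_cst (1 - Lam (s - e))) (Qcvg A mA))).
  apply: filterS (near_s _ e0) => m me /=.
  have [hm Rm _] := hQn m.
  rewrite -lee_fin fineK ?fin_num_measure//.
  by apply: (Rcond_le Lam_decr hm _ Rm) => //; rewrite lerD2l lerN2 ltW.
apply: le_trans (Rfun_ge (EQ P Q X) Rse); rewrite lee_fin le_min lexx andbT.
by apply: le_trans sQ; rewrite gerBl ltW.
Qed.

End attainment.

Theorem theorem3 (d : measure_display) (T : measurableType d) (R : realType)
    (P : probability T R) (Lam : R -> R) :
  atomless P ->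
  (forall x, 0 <= Lam x <= 1) ->
  {homo Lam : x y / x <= y >-> y <= x} ->
  (forall X : T -> R, Linf P X ->
     ES_Lam P Lam X =
     ereal_sup [set Rfun P Lam (EQ P Q X) Q | Q in [set Q | M1f P Q]]) /\
  ((forall x : R, Lam x @[x --> x^'-] --> Lam x) ->
     forall X : T -> R, Linf P X ->
     exists Q, M1f P Q /\ ES_Lam P Lam X = Rfun P Lam (EQ P Q X) Q) /\
  (usc_RM1f P (Rfun P Lam) /\ quasi_concave_RM1f P (Rfun P Lam) /\
   (forall (Q : set T -> R) (t1 t2 : R), M1f P Q -> t1 <= t2 ->
      (Rfun P Lam t1 Q <= Rfun P Lam t2 Q)%E)) /\
  (forall Q Q' : set T -> R, M1f P Q -> M1f P Q' ->
     ereal_inf [set Rfun P Lam t Q | t in [set: R]] =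
     ereal_inf [set Rfun P Lam t Q' | t in [set: R]]) /\
  (forall (Q : set T -> R) (t1 t2 : R), M1f P Q -> t2 <= t1 ->
     (Rfun P Lam t1 Q - Rfun P Lam t2 Q <= (t1 - t2)%:E)%E).
Proof.
move=> _ Lam01 Lam_decr.
have dual := ES_Lam_dual Lam01 (P := P).
split=> [X LX|]; first exact: dual.
split=> [_ X LX|].
  have [Q [hQ QE]] := sup_Rfun_attained Lam01 Lam_decr LX.
  by exists Q; split => //; rewrite dual.
split; first split; [exact: usc_Rfun | split; [exact: quasi_concave_Rfun|]|split].
- by move=> Q t1 t2 _; exact: Rfun_homo.
- by move=> Q Q' _ _; rewrite !ereal_inf_Rfun.
- by move=> Q t1 t2 _; exact: Rfun_lipschitz.
Qed.
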